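(* Let $\epsilon\in(0,1/2)$ and let $\epsilon_1,\dots,\epsilon_d>0$ satisfy $\sum_{t=1}^d\epsilon_t=\epsilon$. Consider the (Gaussian-refined) sequential affine detection procedure described in the context, and let the observation noise be $\xi^d\sim\mathcal N(0,\Theta)$ with $\Theta\in\mathcal U$. Then: (i) when the input $x$ is a feasible nuisance (i.e. $x\in N$), the probability that the procedure terminates with the signal conclusion at time $t\in\{1,\dots,d\}$ does not exceed $\epsilon_t$, and thus the probability of a false alarm (signal conclusion at some time $t\in\{1,\dots,d\}$) is at most $\epsilon=\sum_{t=1}^d\epsilon_t$; (ii) when $t\in\{1,\dots,d\}$ and $k\in\{1,\dots,K\}$ are such that $\rho_{tk}<\infty$, and the input $x$ belongs to a set $X_k^\rho$ with $\rho\ge\rho_{tk}$, the probability that the procedure terminates with the signal conclusion at step $t$ or earlier is at least $1-\epsilon$.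
   Context: **Notation.** $\mathbf S^m$ is the space of real symmetric $m\times m$ matrices, $\mathbf S^m_+$ the cone of positive semidefinite ones. $\mathrm{Erf}(s)=\frac1{\sqrt{2\pi}}\int_s^\infty e^{-r^2/2}dr$, and $\mathrm{ErfInv}(\kappa)=\min\{r:\mathrm{Erf}(r)\le\kappa\}$ for $0<\kappa\le1/2$, $\mathrm{ErfInv}(\kappa)=0$ for $1/2\le\kappa<\infty$; by convention $\mathrm{ErfInv}(\epsilon_t/0):=0$. **Observations.** An unknown deterministic input $x\in\mathbf R^n$ is observed through $y^t=\bar A_tx+\xi^t=S_t[\bar A_dx+\xi^d]\in\mathbf R^{\nu_t}$, $t=1,\dots,d$, where $1\le\nu_1\le\dots\le\nu_d$, $\bar A_d$ is a given $\nu_d\times n$ matrix, $S_t$ is a given $\nu_t\times\nu_d$ matrix of rank $\nu_t$ ($S_d=I$), $S_{t-1}=R_tS_t$ for some matrix $R_t$, $\bar A_t=S_t\bar A_d$, $\xi^t=S_t\xi^d$, and $\xi^d$ is random noise. $\mathcal U$ is a given nonempty convex compact subset of $\mathrm{int}\,\mathbf S^{\nu_d}_+$, and $\mathcal U_t=\{S_t\Theta S_t^T:\Theta\in\mathcal U\}$. **Inputs.** $X\subset\mathbf R^n$ is a convex compact set; the set of feasible nuisances $N\subset X$ is closed and convex with $0\in N$. For $k=1,\dots,K$: $W_k\subset\mathbf R^n$ is a nonempty closed convex set with $0\notin W_k$ and $\rho w\in W_k$ whenever $w\in W_k$, $\rho\ge1$; $V_k\subset X$ is a nonempty compact convex set with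 $0\in V_k$. For $\rho>0$, $W_k^\rho=\{\rho y:y\in W_k\}$ and $X_k^\rho=[V_k+W_k^\rho]\cap X$ (feasible signals of shape $k$ and magnitude $\ge\rho$). It is assumed that for every $k$ the set $X_k^\rho$ is nonempty for some $\rho>0$; $R_k>0$ denotes the largest $\rho$ for which $X_k^\rho\neq\emptyset$. **Saddle point values.** Let $N^t=\bar A_tN$, $U^t_{k\rho}=\{\bar A_tx:x\in X_k^\rho\}$, and for $\rho\in(0,R_k]$ $$\mathcal{SV}_{tk}(\rho)=\min_{h\in\mathbf R^{\nu_t}}\ \max_{\theta_1\in N^t,\ \theta_2\in U^t_{k\rho},\ \Theta\in\mathcal U_t}\left[\tfrac12h^T[\theta_2-\theta_1]+\tfrac12h^T\Theta h\right].$$ A saddle point $(h_{tk\rho};\theta^1_{tk\rho},\theta^2_{tk\rho},\Theta_{tk\rho})$ exists; the associated affine detector is $\phi_{tk\rho}(y^t)=h_{tk\rho}^T\left[y^t-\tfrac12(\theta^1_{tk\rho}+\theta^2_{tk\rho})\right]$. **Procedure.** For $\delta\ge0$ let $\mathcal L_t(\delta)=\{k\le K:\mathcal{SV}_{tk}(R_k)<-\frac12\delta^2\}$, $L_t(\delta)=\mathrm{Card}\,\mathcal L_t(\delta)$, and $$\delta_t=\inf\left\{\delta\ge 0:\ \delta\ge\tfrac12\left[\mathrm{ErfInv}(\epsilon_t/L_t(\delta))+\mathrm{ErfInv}(\epsilon)\right]\right\}.$$ For $k\in\mathcal L_t(\delta_t)$ let $\rho_{tk}\in(0,R_k]$ be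 such that $\mathcal{SV}_{tk}(\rho_{tk})=-\frac12\delta_t^2$ (such $\rho_{tk}$ exists) and set $\phi_{tk}=\phi_{tk\rho_{tk}}$; for $k\notin\mathcal L_t(\delta_t)$ set $\rho_{tk}=+\infty$. Let $\alpha=\frac{\delta_t}2\left[\mathrm{ErfInv}(\epsilon)-\mathrm{ErfInv}(\epsilon_t/L_t(\delta_t))\right]$. At step $t$, given $y^t$: if there is $k$ with $\rho_{tk}<\infty$ and $\phi_{tk}(y^t)<\alpha$, the procedure claims that the input is a signal and terminates (signal conclusion at time $t$); otherwise it passes to time $t+1$ (if $t<d$) or terminates without a signal conclusion (if $t=d$). *)

(* Defs.v *)
From HB Require Import structures.
From mathcomp Require Import all_boot all_order all_algebra.
From mathcomp Require Import all_classical all_reals all_analysis.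

Set Implicit Arguments.
Unset Strict Implicit.
Unset Printing Implicit Defensive.

Import Order.TTheory GRing.Theory Num.Theory.
Import numFieldNormedType.Exports.

Local Open Scope classical_set_scope.
Local Open Scope ring_scope.

Section LinearAlgebra.
Context {R : realType}.

Definition dotv (m : nat) (u v : 'cV[R]_m) : R := (u^T *m v) 0 0.

Definition qform (m : nat) (Th : 'M[R]_m) (h : 'cV[R]_m) : R := dotv h (Th *m h).

Definition symmetric_mx (m : nat) : set 'M[R]_m := [set M | M^T = M].

Definition psd_cone (m : nat) : set 'M[R]_m :=
  [set M | symmetric_mx M /\ forall h, 0 <= qform M h].

(* The interior is taken in the space of symmetric matrices: as a subset of
   'M_m the cone has empty interior when m > 1. *)
Definition int_psd_cone (m : nat) : set 'M[R]_m :=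
  [set M | symmetric_mx M /\ within (@symmetric_mx m) (nbhs M) (@psd_cone m)].

End LinearAlgebra.

Section GaussianTail.
Context {R : realType}.

Definition Erf (s : R) : R :=
  (Num.sqrt (2 * pi))^-1 *
  \int[lebesgue_measure]_(r in `[s, +oo[) expR (- (r ^+ 2) / 2).

(* For 0 < kappa < 1/2 the infimum is a minimum, since Erf is continuous,
   decreasing, and has limits 1 and 0 at -oo and +oo.
   The values for kappa <= 0 are never used. *)
Definition ErfInv (kappa : R) : R :=
  if 2^-1 <= kappa then 0 else inf [set r : R | Erf r <= kappa].

(* ErfInv (e / L) with the convention ErfInv (e / 0) := 0; the case split is
   needed because e / 0 = 0 in R. *)
Definition ErfInv_div (e : R) (L : nat) : R :=
  if L == 0%N then 0 else ErfInv (e / L%:R).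

(* The univariate law N(0, v); normal_prob takes the standard deviation and
   requires it to be nonzero. *)
Definition centered_normal (v : R) (B : set R) : \bar R :=
  if v == 0 then \d_(0 : R) B else normal_prob 0 (Num.sqrt v) B.

(* xi ~ N(0, Theta): a random vector is Gaussian when all its linear functionals
   are (possibly degenerate) normal variables, and centered with covariance
   Theta when the functional u has mean 0 and variance u^T Theta u. *)
Definition gaussian_vector (dsp : measure_display) (T : measurableType dsp)
    (P : probability T R) (m : nat) (xi : T -> 'cV[R]_m) (Th : 'M[R]_m) : Prop :=
  forall u : 'cV[R]_m,
    measurable_fun [set: T] (fun w => dotv u (xi w)) /\
    forall B : set R, measurable B ->
      P [set w | B (dotv u (xi w))] = centered_normal (qform Th u) B.

End GaussianTail.

Section SaddlePoints.
Context {R : realType} {m : nat}.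

Definition payoff (h th1 th2 : 'cV[R]_m) (Th : 'M[R]_m) : R :=
  2^-1 * dotv h (th2 - th1) + 2^-1 * qform Th h.

Definition saddle_value (N U : set 'cV[R]_m) (C : set 'M[R]_m) : \bar R :=
  ereal_inf [set ereal_sup
    [set z | exists th1 th2 Th,
       [/\ N th1, U th2, C Th & z = (payoff h th1 th2 Th)%:E]]
    | h in [set: 'cV[R]_m]].

Definition saddle_point (N U : set 'cV[R]_m) (C : set 'M[R]_m)
    (h th1 th2 : 'cV[R]_m) (Th : 'M[R]_m) : Prop :=
  [/\ N th1, U th2, C Th,
      forall h', payoff h th1 th2 Th <= payoff h' th1 th2 Th &
      forall th1' th2' Th', N th1' -> U th2' -> C Th' ->
        payoff h th1' th2' Th' <= payoff h th1 th2 Th].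

End SaddlePoints.

(* Times range over 'I_d.+1 = {0, ..., d}, i.e. there are d.+1 >= 1 time
   instants, the last one being ord_max; shapes range over 'I_K. *)
Record detection_problem (R : realType) (n d K : nat) := DetectionProblem {
  nu : 'I_d.+1 -> nat;
  Abar_last : 'M[R]_(nu ord_max, n);
  Smx : forall t : 'I_d.+1, 'M[R]_(nu t, nu ord_max);
  covs : set 'M[R]_(nu ord_max);
  Xset : set 'cV[R]_n;
  Nset : set 'cV[R]_n;
  Wset : 'I_K -> set 'cV[R]_n;
  Vset : 'I_K -> set 'cV[R]_n;

  nu_ge1 : forall t, (1 <= nu t)%N;
  nu_mono : forall s t : 'I_d.+1, (s <= t)%N -> (nu s <= nu t)%N;
  S_rank : forall t, \rank (Smx t) = nu t;
  S_last : Smx ord_max = 1%:M;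
  S_step : forall s t : 'I_d.+1, t = s.+1 :> nat ->
    exists Rt : 'M[R]_(nu s, nu t), Smx s = Rt *m Smx t;

  covs_neq0 : covs !=set0;
  covs_convex : convex_set covs;
  covs_compact : compact covs;
  covs_int : covs `<=` @int_psd_cone R (nu ord_max);

  X_convex : convex_set Xset;
  X_compact : compact Xset;
  N_subX : Nset `<=` Xset;
  N_closed : closed Nset;
  N_convex : convex_set Nset;
  N_0 : Nset 0;

  W_neq0 : forall k, Wset k !=set0;
  W_closed : forall k, closed (Wset k);
  W_convex : forall k, convex_set (Wset k);
  W_not0 : forall k, ~ Wset k 0;
  W_scale : forall k w (rho : R), Wset k w -> 1 <= rho -> Wset k (rho *: w);

  V_neq0 : forall k, Vset k !=set0;
  V_subX : forall k, Vset k `<=` Xset;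
  V_compact : forall k, compact (Vset k);
  V_convex : forall k, convex_set (Vset k);
  V_0 : forall k, Vset k 0;

  signal_exists : forall k, exists2 rho : R, 0 < rho &
    exists x v w, [/\ Xset x, Vset k v, Wset k w & x = v + rho *: w]
}.

Arguments Smx {R n d K} _ t.
Arguments covs {R n d K} _.
Arguments Abar_last {R n d K} _.

Unset Implicit Arguments.

Section Procedure.
Context {R : realType} {n d K : nat} (D : detection_problem R n d K).
Implicit Types (t : 'I_d.+1) (k : 'I_K) (rho : R).

Definition Wscaled k rho : set 'cV[R]_n := [set rho *: y | y in Wset D k].

Definition Xsig k rho : set 'cV[R]_n :=
  [set v + w | v in Vset D k & w in Wscaled k rho] `&` Xset D.

(* The largest rho with Xsig k rho nonempty (the supremum is attained, by
   compactness of Xset and Vset k, closedness of Wset k, and ~ Wset k 0). *)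
Definition rho_max k : R := sup [set rho | 0 < rho /\ Xsig k rho !=set0].

Definition Abar t : 'M[R]_(nu D t, n) := Smx D t *m Abar_last D.

Definition covs_at t : set 'M[R]_(nu D t) :=
  [set Smx D t *m Th *m (Smx D t)^T | Th in covs D].

Definition N_at t : set 'cV[R]_(nu D t) := [set Abar t *m x | x in Nset D].

Definition U_at t k rho : set 'cV[R]_(nu D t) :=
  [set Abar t *m x | x in Xsig k rho].

Definition SV t k rho : \bar R :=
  saddle_value (N_at t) (U_at t k rho) (covs_at t).

Section Levels.
Variables (eps : R) (epst : 'I_d.+1 -> R).

Definition calL t (delta : R) : {set 'I_K} :=
  [set k | (SV t k (rho_max k) < (- (2^-1 * delta ^+ 2))%:E)%E]%SET.

Definition Lcard t (delta : R) : nat := #|calL t delta|.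

Definition delta_at t : R :=
  inf [set delta : R | 0 <= delta /\
    2^-1 * (ErfInv_div (epst t) (Lcard t delta) + ErfInv eps) <= delta].

Definition alpha_at t : R :=
  delta_at t / 2 *
  (ErfInv eps - ErfInv_div (epst t) (Lcard t (delta_at t))).

(* The choices left open in the construction: saddle points at all admissible
   (t, k, rho), and the thresholds rho_tk in (0, +oo]. *)
Record procedure := MkProcedure {
  sp_h : forall t, 'I_K -> R -> 'cV[R]_(nu D t);
  sp_th1 : forall t, 'I_K -> R -> 'cV[R]_(nu D t);
  sp_th2 : forall t, 'I_K -> R -> 'cV[R]_(nu D t);
  sp_Th : forall t, 'I_K -> R -> 'M[R]_(nu D t);
  sp_saddle : forall t k rho, 0 < rho <= rho_max k ->
    saddle_point (N_at t) (U_at t k rho) (covs_at t)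
      (sp_h t k rho) (sp_th1 t k rho) (sp_th2 t k rho) (sp_Th t k rho);

  rho_at : 'I_d.+1 -> 'I_K -> \bar R;
  rho_at_in : forall t k, k \in calL t (delta_at t) ->
    exists rho, [/\ rho_at t k = rho%:E, 0 < rho <= rho_max k &
                    SV t k rho = (- (2^-1 * delta_at t ^+ 2))%:E];
  rho_at_notin : forall t k, k \notin calL t (delta_at t) ->
    rho_at t k = +oo%E
}.

Variable p : procedure.

Definition detector t k rho (y : 'cV[R]_(nu D t)) : R :=
  dotv (sp_h p t k rho) (y - 2^-1 *: (sp_th1 p t k rho + sp_th2 p t k rho)).

Definition signal_test t (y : 'cV[R]_(nu D t)) : Prop :=
  exists2 k, (rho_at p t k < +oo)%E &
    detector t k (fine (rho_at p t k)) y < alpha_at t.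

Definition observation t (x : 'cV[R]_n) (xi : 'cV[R]_(nu D ord_max)) :
    'cV[R]_(nu D t) :=
  Smx D t *m (Abar_last D *m x + xi).

(* The set of noise outcomes w for which the procedure terminates at time t with
   the signal conclusion, i.e. the test fires at time t and not earlier. *)
Definition signal_event {T : Type} (xi : T -> 'cV[R]_(nu D ord_max))
    (x : 'cV[R]_n) t : set T :=
  [set w | signal_test t (observation t x (xi w)) /\
           forall s : 'I_d.+1, (s < t)%N ->
             ~ signal_test s (observation s x (xi w))].

End Levels.
End Procedure.

Arguments rho_at {R n d K D eps epst} p t k.
Arguments signal_event {R n d K D eps epst} p {T} xi x t.

(* Main.v *)
(* Let (h; th1, th2, Th) be the saddle point selected for (t, k), with value
   - delta^2 / 2.  Stationarity of the payoff along the ray through h gives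
   h^T Th h = delta^2 and h^T (th2 - th1) = - 2 delta^2, and maximality in the
   other variables shows that the noise term h^T S_t xi has variance at most
   delta^2, while the mean of the detector is at least delta^2 on nuisances and
   at most - delta^2 on the signals of shape k and magnitude at least rho_tk.
   Writing a = ErfInv eps and b = ErfInv (eps_t / L_t), a false alarm of shape k
   at time t then requires a Gaussian deviation below - delta b, and a miss one
   above delta a, as soon as delta >= (a + b) / 2; the union bound over the L_t
   shapes concludes.  That delta_t satisfies this inequality (the infimum that
   defines it is attained) holds because L_t is a right-continuous step
   function of delta. *)
Require Import Defs.
From mathcomp Require Import all_boot all_order all_algebra.
From mathcomp Require Import all_classical all_reals all_analysis measurable_realfun.
From mathcomp Require Import ring lra.

Import Order.TTheory GRing.Theory Num.Theory.
Import numFieldNormedType.Exports.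

Local Open Scope classical_set_scope.
Local Open Scope ring_scope.

(** * Tails of normal laws and the inverse [ErfInv] *)

Section GaussianTails.
Context {R : realType}.
Implicit Types s sigma a c v kappa : R.

(** Seeing [Erf] as a mass of the standard normal law makes monotonicity and continuity of measures
    available for it. *)
Lemma Erf_normal_prob s : (Erf s)%:E = normal_prob 0 1 `[s, +oo[.
Proof.
have pdfE x : normal_pdf 0 1 x = (Num.sqrt (2 * pi))^-1 * expR (- (x ^+ 2) / 2) :> R.
  rewrite normal_pdfE ?oner_eq0// /normal_peak /normal_fun subr0 expr1n mul1r.
  by rewrite -mulr_natl.
rewrite /Erf /Rintegral -[LHS]/(((Num.sqrt (2 * pi))^-1 * _)%:E).
have mE : measurable_fun `[s, +oo[ (fun x : R => expR (- (x ^+ 2) / 2)).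
  apply: measurable_funTS; apply: measurableT_comp => //.
  by apply: measurable_funM => //; apply: measurableT_comp => //; exact: measurable_funX.
have sp : 0 < (Num.sqrt (2 * pi))^-1 :> R by rewrite invr_gt0 sqrtr_gt0 mulr_gt0 ?pi_gt0.
have E : normal_prob 0 1 `[s, +oo[ = ((Num.sqrt (2 * pi))^-1%:E *
    \int[lebesgue_measure]_(r in `[s, +oo[) (expR (- (r ^+ 2) / 2))%:E)%E.
  rewrite /normal_prob; under eq_integral do rewrite pdfE EFinM.
  rewrite ge0_integralZl//= ?lee_fin ?ltW//.
  exact/measurable_EFinP.
rewrite E EFinM fineK//.
(* [fineK] asks for a finite integral: an infinite one, multiplied by a positive constant, would
   make this probability infinite. *)
have : normal_prob 0 1 `[s, +oo[ \is a fin_num by apply: fin_num_measure.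
rewrite E; case: (integral _ _ _) => [r| |]//.
- by rewrite gt0_muley// lte_fin.
- by rewrite gt0_muleNy// lte_fin.
Qed.

Lemma normal_prob_scale {sigma} s : 0 < sigma ->
  normal_prob 0 sigma `[sigma * s, +oo[ = normal_prob 0 1 `[s, +oo[.
Proof.
move=> s0; rewrite /normal_prob.
have dF : (fun x : R => sigma * x)^`()%classic = cst sigma.
  apply/funext => x; rewrite derive1E deriveMl// derive_id /=.
  exact: mulr1.
rewrite (@increasing_ge0_integration_by_substitutiony _ (fun x : R => sigma * x)).
- apply: eq_integral => x _; congr EFin; rewrite dF /= !fctE.
  rewrite !normal_pdfE ?oner_eq0 ?gt_eqF// /normal_peak /normal_fun !subr0.
  rewrite expr1n mul1r -[_ *+ 2]mulrnAr sqrtrM ?sqr_ge0// sqrtr_sqr gtr0_norm//.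
  have -> : - (sigma * x) ^+ 2 / (sigma ^+ 2 *+ 2) = - x ^+ 2 / (1 *+ 2).
    by field; rewrite gt_eqF.
  by rewrite invfM mulrC !mulrA divff ?gt_eqF// mul1r.
- by move=> x y _ _; rewrite ltr_pM2l.
- by rewrite dF => x _; exact: cst_continuous.
- by rewrite dF; exact: is_cvg_cst.
- by rewrite dF; exact: is_cvg_cst.
- split=> [x _|]; first by apply: derivableM.
  by apply: cvg_at_right_filter; apply: cvgMl_tmp; exact: cvg_id.
- by apply/gt0_cvgMry => //; exact: cvg_id.
- by apply: continuous_subspaceT; apply: continuous_normal_pdf; rewrite gt_eqF.
- by move=> x _; exact: normal_pdf_ge0.
Qed.

Lemma normal_prob_reflect sigma a : sigma != 0 ->
  normal_prob 0 sigma `]-oo, - a] = normal_prob 0 sigma `[a, +oo[.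
Proof.
move=> s0; rewrite /normal_prob ge0_integration_by_substitutionNy.
- apply: eq_integral => x _; congr EFin => /=.
  by rewrite !normal_pdfE// /normal_fun !subr0 sqrrN.
- by apply: continuous_subspaceT; apply: continuous_normal_pdf.
- by move=> x _; exact: normal_pdf_ge0.
Qed.

Lemma Erf_le {r s} : r <= s -> Erf s <= Erf r :> R.
Proof.
move=> rs; rewrite -lee_fin !Erf_normal_prob le_measure ?inE//.
by apply: subset_itvr; rewrite bnd_simp.
Qed.

(** The half-lines on both sides of 0 cover the line and have equal mass by reflection, so
    subadditivity applies. *)
Lemma Erf0_ge_half : 2^-1 <= Erf 0 :> R.
Proof.
rewrite -(ler_pM2l (ltr0n _ 2)) divff// mulrDl mul1r -lee_fin EFinD.
rewrite {1}Erf_normal_prob -normal_prob_reflect ?oner_eq0// oppr0 Erf_normal_prob.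
rewrite -(probability_setT (normal_prob 0 1)).
rewrite (_ : setT = `]-oo, 0] `|` `[0, +oo[); last first.
  apply/seteqP; split=> x //= _; rewrite !in_itv/= andbT.
  by apply/orP; exact: le_total.
exact: measureU2.
Qed.

Lemma Erf_arbitrarily_small kappa : 0 < kappa -> exists r, Erf r <= kappa.
Proof.
move=> k0.
have Ecap : \bigcap_n `[n%:R, +oo[%classic = set0 :> set R.
  rewrite -subset0 => x /(_ (Num.truncn x).+1 I) /=.
  by rewrite in_itv/= andbT leNgt truncnS_gt.
have : (normal_prob 0 1 \o (fun n => `[n%:R, +oo[%classic)) n @[n --> \oo] -->
    normal_prob 0 1 (\bigcap_n `[n%:R, +oo[%classic : set R).
  apply: nonincreasing_cvg_mu => //.
  - exact: le_lt_trans (probability_le1 _ _) (ltry 1).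
  - by rewrite Ecap.
  - move=> m n mn; apply/subsetPset; apply: subset_itvr.
    by rewrite bnd_simp ler_nat.
rewrite Ecap measure0 => /fine_cvgP[_] /cvgr_lt /(_ _ k0) [N _ /(_ N (leqnn N))].
by rewrite /= -Erf_normal_prob => /ltW; exists N%:R.
Qed.

(** Since [Erf] is at least 1/2 on [r <= 0], the set defining the infimum has 0 as a lower bound,
    and 0 cannot be its infimum once the infimum is shown to be attained. *)
Lemma ErfInv_bounds kappa : 0 < kappa < 2^-1 ->
  0 < ErfInv kappa /\ Erf (ErfInv kappa) <= kappa.
Proof.
move=> /andP[k0 k1]; rewrite /ErfInv leNgt k1 /=.
set S := [set r | _]; set a := inf S.
have Slb r : S r -> 0 <= r.
  move=> Sr; rewrite leNgt; apply/negP => r0.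
  have := le_trans (le_trans Erf0_ge_half (Erf_le (ltW r0))) Sr.
  by rewrite leNgt k1.
have Sinf : has_inf S.
  by split; [exact: Erf_arbitrarily_small | exists 0 => r; exact: Slb].
have Ea : Erf a <= kappa.
  (* The law has no atom at [a], so the open half-line, an increasing union of the half-lines
     starting at [a + 1/(n+1)], has the same mass. Each of these starts above some element of
     [S]. *)
  have Eo : (Erf a)%:E = normal_prob 0 1 `]a, +oo[.
    rewrite Erf_normal_prob -(@setU1itv _ _ _ a false) ?bnd_simp// measureU//=.
    - rewrite (_ : normal_prob 0 1 [set a] = 0) ?add0e//.
      have /null_content_dominatesP := normal_prob_dominates 0 (1 : R).
      by apply=> //; exact: lebesgue_measure_set1.
    - by rewrite -subset0 => x []/= ->; rewrite in_itv/= ltxx.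
  have : (normal_prob 0 1 \o (fun n => `[a + n.+1%:R^-1, +oo[%classic)) n @[n --> \oo] -->
      normal_prob 0 1 (\bigcup_n `[a + n.+1%:R^-1, +oo[%classic : set R).
    apply: nondecreasing_cvg_mu => //; first exact: bigcup_measurable.
    move=> m n mn; apply/subsetPset; apply: subset_itvr.
    by rewrite bnd_simp lerD2l lef_pV2 ?posrE// ler_nat.
  rewrite -itvoyEbigcup -Eo => cv; rewrite -lee_fin.
  apply: (cvge_to_le cv).
  apply: nearW => n /=.
  rewrite -Erf_normal_prob lee_fin.
  have [|s Ss sa] := @inf_adherent _ S n.+1%:R^-1 _ Sinf; first by rewrite invr_gt0.
  exact: le_trans (Erf_le (ltW sa)) Ss.
split=> //; rewrite lt_neqAle; apply/andP; split.
  apply: contraTneq k1 => a0; rewrite -leNgt.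
  by apply: le_trans Ea; rewrite -a0 Erf0_ge_half.
by apply: lb_le_inf => //; case: Sinf.
Qed.

(** For [v > 0], rescaling reduces to a threshold [sqrt v * r <= delta * r]. For [v = 0] the closed
    half-line must miss the atom 0, whence the strict signs of [delta] and [r]. *)
Lemma centered_normal_upper_tail v delta r : 0 <= v <= delta ^+ 2 ->
  0 < delta -> 0 < r -> (centered_normal v `[(delta * r)%R, +oo[ <= (Erf r)%:E)%E.
Proof.
move=> /andP[v0 vd] d0 r0; rewrite /centered_normal; case: eqVneq => [_|vn0].
  rewrite diracE memNset ?lee_fin//=.
    by rewrite -lee_fin Erf_normal_prob measure_ge0.
  by rewrite in_itv/= andbT leNgt mulr_gt0.
have sv0 : 0 < Num.sqrt v by rewrite sqrtr_gt0 lt_neqAle eq_sym vn0.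
rewrite Erf_normal_prob -(normal_prob_scale r sv0) le_measure ?inE//.
apply: subset_itvr; rewrite bnd_simp ler_pM2r//.
by rewrite -(ger0_norm (ltW d0)) -sqrtr_sqr ler_wsqrtr.
Qed.

(** Reflected version. The half-line is open, so it misses the atom 0 even when [delta * r = 0]. *)
Lemma centered_normal_lower_tail v delta r : 0 <= v <= delta ^+ 2 ->
  0 <= delta -> 0 <= r -> (centered_normal v `]-oo, (- (delta * r))%R[ <= (Erf r)%:E)%E.
Proof.
move=> /andP[v0 vd] d0 r0; rewrite /centered_normal; case: eqVneq => [_|vn0].
  rewrite diracE memNset ?lee_fin//=.
    by rewrite -lee_fin Erf_normal_prob measure_ge0.
  by rewrite in_itv/= ltNge oppr_le0 mulr_ge0.
have sv0 : 0 < Num.sqrt v by rewrite sqrtr_gt0 lt_neqAle eq_sym vn0.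
rewrite Erf_normal_prob -(normal_prob_scale r sv0) -normal_prob_reflect ?gt_eqF//.
rewrite le_measure ?inE//.
apply: subset_itvl; rewrite bnd_simp lerN2 ler_wpM2r//.
by rewrite -(ger0_norm d0) -sqrtr_sqr ler_wsqrtr.
Qed.
End GaussianTails.

(** * Bilinear algebra and saddle points of the payoff *)

Section Saddle.
Context {R : realType}.

Lemma dotvDr m (h u v : 'cV[R]_m) : dotv h (u + v) = dotv h u + dotv h v.
Proof. by rewrite /dotv mulmxDr mxE. Qed.

Lemma dotvZr m (h u : 'cV[R]_m) a : dotv h (a *: u) = a * dotv h u.
Proof. by rewrite /dotv -scalemxAr mxE. Qed.

Lemma dotvNr m (h u : 'cV[R]_m) : dotv h (- u) = - dotv h u.
Proof. by rewrite /dotv mulmxN mxE. Qed.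

Lemma dotvZl m (h u : 'cV[R]_m) a : dotv (a *: h) u = a * dotv h u.
Proof. by rewrite /dotv linearZ /= -scalemxAl mxE. Qed.

Lemma dotv_mulmx m q (h : 'cV[R]_m) (S : 'M[R]_(m, q)) u :
  dotv h (S *m u) = dotv (S^T *m h) u.
Proof. by rewrite /dotv trmx_mul trmxK mulmxA. Qed.

Lemma qform_congr m q (S : 'M[R]_(m, q)) Th h :
  qform (S *m Th *m S^T) h = qform Th (S^T *m h).
Proof. by rewrite /qform -!mulmxA dotv_mulmx. Qed.

Context {m : nat}.
Implicit Types (N U : set 'cV[R]_m) (C : set 'M[R]_m).

(** Choosing [h] in the infimum gives one inequality; keeping [(th1, th2, Th)] in each supremum
    gives the other. *)
Lemma saddle_valueE {N U C h th1 th2 Th} : saddle_point N U C h th1 th2 Th ->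
  saddle_value N U C = (payoff h th1 th2 Th)%:E.
Proof.
case=> N1 U2 CT minh maxth; apply/eqP; rewrite eq_le; apply/andP; split.
  apply: ge_ereal_inf; exists (ereal_sup [set z | exists th1 th2 Th,
       [/\ N th1, U th2, C Th & z = (payoff h th1 th2 Th)%:E]]).
    by exists h.
  by apply: ge_ereal_sup => _ [a [b [c [Na Ub Cc ->]]]]; rewrite lee_fin maxth.
apply: le_ereal_inf_tmp => _ [h' _ <-].
apply: le_ereal_sup_tmp; exists (payoff h' th1 th2 Th)%:E; last by rewrite lee_fin.
by exists th1, th2, Th.
Qed.

(* Minimality along the ray through h forces the linear part of the payoff to
   be minus twice its quadratic part. *)
Lemma saddle_point_stationary {N U C h th1 th2 Th} :
  saddle_point N U C h th1 th2 Th -> dotv h (th2 - th1) = - 2 * qform Th h.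
Proof.
case=> _ _ _ minh _.
set l := dotv h _; set q := qform _ _.
have ineq t : 0 <= t * (l + 2 * q + t * q).
  have := minh ((1 + t) *: h).
  rewrite /payoff /qform -scalemxAr !dotvZl dotvZr -/l -[dotv h (Th *m h)]/q; nra.
set e := l + 2 * q in ineq; suff: e = 0 by rewrite /e; lra.
(* The trial point is [t = - e / c]. Any positive [c] exceeding [q] makes the value there negative
   unless [e = 0]. *)
pose c := 1 + q ^+ 2; have c0 : 0 < c by rewrite /c; nra.
have := ineq (- e / c).
have -> : - e / c * (e + - e / c * q) = (e / c) ^+ 2 * (q - c).
  by field; rewrite gt_eqF.
move=> ec.
have : (e / c) ^+ 2 = 0.
  apply/eqP; rewrite eq_le sqr_ge0 andbT.
  have cq : q < c by rewrite /c; nra.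
  by move: ec; rewrite nmulr_lge0// subr_lt0.
by move/eqP; rewrite sqrf_eq0 mulf_eq0 invr_eq0 (gt_eqF c0) orbF => /eqP.
Qed.


End Saddle.

(** Union bound, used once over shapes and once over times. *)
Lemma content_finite_union_bound {R : realFieldType} {dsp : measure_display}
    {T : ringOfSetsType dsp} (mu : {content set T -> \bar R}) {I : finType}
    (Q : {set I}) (A : set T) (A_ : I -> set T) (c : I -> R) :
  measurable A -> (forall i, i \in Q -> measurable (A_ i)) ->
  A `<=` \bigcup_(i in [set` Q]) A_ i ->
  (forall i, i \in Q -> (mu (A_ i) <= (c i)%:E)%E) ->
  (mu A <= (\sum_(i in Q) c i)%:E)%E.
Proof.
move=> mA mA_ sub le_c; have fQ : finite_set [set` Q] by exact: finite_finpred.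
apply: le_trans (content_sub_fsum mu fQ mA_ mA sub) _.
rewrite -sumEFin (bigfs _ (index_enum_uniq I))//=; last by move=> i; rewrite mem_index_enum.
exact: lee_fsum.
Qed.

(** * Attainment of the infimum defining [delta_at] *)

Section Thresholds.
Context {R : realType} {n d K : nat} (D : detection_problem R n d K).
Variables (eps : R) (epst : 'I_d.+1 -> R).
Implicit Types (t : 'I_d.+1) (delta : R).

Lemma calL_antitone t {delta1 delta2} : 0 <= delta1 <= delta2 ->
  calL D t delta2 \subset calL D t delta1.
Proof.
move=> /andP[d0 d12]; apply/fintype.subsetP => k; rewrite !inE => /lt_le_trans; apply.
rewrite lee_fin lerN2 ler_pM2l ?invr_gt0//.
by rewrite ler_pXn2r ?nnegrE// (le_trans d0).
Qed.

(** Membership is a strict inequality, so the finitely many members at [delta0] persist nearby; by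
    antitonicity no shape enters to the right of [delta0]. *)
Lemma calL_right_continuous t delta0 : 0 <= delta0 ->
  exists2 e, 0 < e &
    forall delta, delta0 <= delta < delta0 + e -> calL D t delta = calL D t delta0.
Proof.
move=> d0.
have near_k k : \forall delta \near delta0,
    k \in calL D t delta0 -> k \in calL D t delta.
  have [kL|] := boolP (k \in calL D t delta0); last first.
    by move=> _; apply: filterE.
  move: kL; rewrite inE; case E: (SV D t k _) => [r| |]; last 2 first.
  - by rewrite ltNge leey.
  - by move=> _; apply: filterE => delta _; rewrite inE E ltNyr.
  rewrite lte_fin => rlt.
  have cf : - (2^-1 * delta ^+ 2) @[delta --> delta0] --> - (2^-1 * delta0 ^+ 2).
    by apply: cvgN; apply: cvgMl_tmp; exact: exprn_continuous.
  move/cvgr_gt : cf => /(_ _ rlt); apply: filterS => delta rd _.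
  by rewrite inE E lte_fin.
have [e /= e0 near_sub] := @filter_forall _ _ _ _ _ near_k; exists e => // delta /andP[ld ud].
apply/eqP; rewrite finset.eqEsubset calL_antitone ?d0//=; apply/fintype.subsetP => k.
by apply: near_sub; rewrite /= ler0_norm; lra.
Qed.

Lemma delta_at_bounds t : 0 <= delta_at D eps epst t /\
  2^-1 * (ErfInv_div (epst t) (Lcard D t (delta_at D eps epst t)) + ErfInv eps)
    <= delta_at D eps epst t.
Proof.
rewrite /delta_at; set S := [set delta : R | _]; set d0 := inf S.
have lbS : lbound S 0 by move=> x [].
have infS : has_inf S.
  split; last by exists 0.
  (* The cardinality takes only the values [0, ..., K], so this sum dominates every possible
     right-hand side, and [c] is admissible. *)
  pose c := `|ErfInv eps| + \sum_(L < K.+1) `|ErfInv_div (epst t) L|.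
  exists c; split; first by rewrite addr_ge0// sumr_ge0.
  have LK : (Lcard D t c < K.+1)%N.
    by rewrite ltnS -[leqRHS]card_ord; exact: max_card.
  have le1 : ErfInv_div (epst t) (Lcard D t c) <= \sum_(L < K.+1) `|ErfInv_div (epst t) L|.
    rewrite (bigD1 (Ordinal LK))//= (le_trans (ler_norm _))// lerDl.
    exact: sumr_ge0.
  have := ler_norm (ErfInv eps); have := normr_ge0 (ErfInv eps).
  have : 0 <= \sum_(L < K.+1) `|ErfInv_div (epst t) L| by exact: sumr_ge0.
  move: le1; rewrite {3}/c; lra.
have d0_ge0 : 0 <= d0 by apply: lb_le_inf => //; case: infS.
split=> //; rewrite leNgt; apply/negP => d0_lt.
have [e e0 eqL] := @calL_right_continuous t _ d0_ge0.
set c := _ * _ in d0_lt.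
(* If the inequality failed at [d0], some admissible [delta] would lie below [c] and within [e] of
   [d0]; having the same [calL], it would also satisfy [c <= delta]. *)
have [|delta Sdelta dlt] := @inf_adherent _ S (Num.min e (c - d0)) _ infS.
  by rewrite lt_min e0 subr_gt0.
have d0le : d0 <= delta by apply: ge_inf => //; case: infS.
move: dlt; rewrite -ltrBlDl lt_min => /andP[dlte dltc].
case: Sdelta => _; rewrite /Lcard eqL ?d0le -?ltrBlDl//.
rewrite -/(Lcard _ _ _) -/c; lra.
Qed.

End Thresholds.

(** * Mean and noise variance of a selected detector *)

Section Detector.
Context {R : realType} {n d K : nat} {D : detection_problem R n d K}.
Context {eps : R} {epst : 'I_d.+1 -> R} (p : procedure D eps epst).
Variables (t : 'I_d.+1) (k : 'I_K).
Hypothesis fin_rho : (rho_at p t k < +oo)%E.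

Let rho := fine (rho_at p t k).
Let h := sp_h D eps epst p t k rho.
Let delta := delta_at D eps epst t.

(** The noise term of the detector, [h^T S_t xi], is the linear functional of [xi] given by this
    vector, to which [gaussian_vector] applies. *)
Definition noise_direction := (Smx D t)^T *m h.

Lemma shape_in_calL : k \in calL D t delta.
Proof.
by apply: contraLR fin_rho => /(rho_at_notin _ _ _ p) ->; rewrite ltxx.
Qed.

Lemma rho_atE : [/\ rho_at p t k = rho%:E, 0 < rho <= rho_max D k &
  SV D t k rho = (- (2^-1 * delta ^+ 2))%:E].
Proof.
have [r [E rI SVr]] := rho_at_in _ _ _ p _ _ shape_in_calL.
by rewrite /rho E.
Qed.

Let th1 := sp_th1 D eps epst p t k rho.
Let th2 := sp_th2 D eps epst p t k rho.
Let Th := sp_Th D eps epst p t k rho.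

Let saddle : saddle_point (N_at D t) (U_at D t k rho) (covs_at D t) h th1 th2 Th.
Proof. by apply: sp_saddle; case: rho_atE. Qed.

(** By stationarity the value of the saddle point is minus half its quadratic part, and it equals
    [- delta ^+ 2 / 2]. *)
Lemma saddle_quadratic : qform Th h = delta ^+ 2.
Proof.
have [_ _] := rho_atE; rewrite /SV (saddle_valueE saddle) /payoff => -[].
rewrite (saddle_point_stationary saddle); lra.
Qed.

Lemma saddle_linear : dotv h (th2 - th1) = - 2 * delta ^+ 2.
Proof. by rewrite (saddle_point_stationary saddle) saddle_quadratic. Qed.

Lemma noise_variance_bounds Theta : covs D Theta ->
  0 <= qform Theta noise_direction <= delta ^+ 2.
Proof.
move=> Theta_in; apply/andP; split.
  (* An interior point lies in each of its neighbourhoods, hence in the cone itself. *)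
  have [sym psd_near] := covs_int Theta_in.
  by have [_] := nbhs_singleton psd_near sym; apply.
case: saddle => N1 U2 _ _ /(_ th1 th2 _ N1 U2 (ex_intro2 _ _ Theta Theta_in erefl)).
rewrite /payoff lerD2l ler_pM2l ?invr_gt0// saddle_quadratic.
by rewrite qform_congr.
Qed.

Lemma detectorE x xi :
  detector D eps epst p t k rho (observation D t x xi) =
  dotv h (Abar D t *m x) - 2^-1 * (dotv h th1 + dotv h th2) + dotv noise_direction xi.
Proof.
rewrite /detector /observation mulmxDr mulmxA -/(Abar D t).
rewrite !(dotvDr, dotvNr, dotvZr) (dotv_mulmx _ _ h (Smx D t)).
rewrite /noise_direction -/th1 -/th2 -/h.
by rewrite addrAC.
Qed.

(** Maximality in [th1] alone shows that [h^T th1] is least over nuisances, so the mean is at least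
    [h^T (th1 - th2) / 2]. *)
Lemma detector_nuisance x xi : Nset D x ->
  delta ^+ 2 + dotv noise_direction xi <=
    detector D eps epst p t k rho (observation D t x xi).
Proof.
move=> Nx; rewrite detectorE.
case: saddle => _ U2 CT _ /(_ _ th2 Th (ex_intro2 _ _ x Nx erefl) U2 CT).
have := saddle_linear; rewrite /payoff !(dotvDr, dotvNr); lra.
Qed.

(** Write [rho2 *: w] as [rho1 *: ((rho2 / rho1) *: w)]; the inner vector stays in the set since the
    ratio is at least 1. *)
Lemma Xsig_le (rho1 rho2 : R) : 0 < rho1 <= rho2 -> Xsig D k rho2 `<=` Xsig D k rho1.
Proof.
move=> /andP[r1 r12] _ [[v Vv [_ [w Ww <-] <-]] Xx]; split=> //.
exists v => //; exists (rho2 *: w) => //; exists ((rho2 / rho1) *: w).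
  by apply: W_scale => //; rewrite ler_pdivlMr// mul1r.
by rewrite scalerA mulrC divfK// gt_eqF.
Qed.

Lemma detector_signal x xi (rho' : R) : (rho_at p t k <= rho'%:E)%E ->
  Xsig D k rho' x ->
  detector D eps epst p t k rho (observation D t x xi) <=
    - delta ^+ 2 + dotv noise_direction xi.
Proof.
have [-> /andP[rho_gt0 _] _] := rho_atE; rewrite lee_fin => le_rho Xx.
have {}Xx : Xsig D k rho x by apply: Xsig_le Xx; rewrite rho_gt0.
rewrite detectorE.
case: saddle => N1 _ CT _ /(_ th1 _ Th N1 (ex_intro2 _ _ x Xx erefl) CT).
have := saddle_linear; rewrite /payoff !(dotvDr, dotvNr); lra.
Qed.

End Detector.

(** * Measurability and error probabilities of the tests *)

Section Probabilities.
Context {R : realType} {n d K : nat} {D : detection_problem R n d K}.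
Context {eps : R} {epst : 'I_d.+1 -> R} (p : procedure D eps epst).
Context {dsp : measure_display} {T : measurableType dsp} (P : probability T R).
Context {Theta : 'M[R]_(nu D ord_max)} (Theta_in : covs D Theta).
Context (xi : T -> 'cV[R]_(nu D ord_max)) (xi_gauss : gaussian_vector P xi Theta).
Hypotheses (eps_gt0 : 0 < eps) (eps_lt_half : eps < 2^-1).
Hypotheses (epst_gt0 : forall t, 0 < epst t) (epst_le : forall t, epst t <= eps).

Let dt t := delta_at D eps epst t.
Let rho t k := fine (rho_at p t k).

Definition detector_event x t k : set T :=
  [set w | detector D eps epst p t k (rho t k) (observation D t x (xi w))
             < alpha_at D eps epst t].

(** Earlier times are ignored here, so this event contains [signal_event]. *)
Definition test_event x t : set T :=
  [set w | signal_test D eps epst p t (observation D t x (xi w))].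

Lemma test_eventE x t :
  test_event x t = \bigcup_(k in [set k | (rho_at p t k < +oo)%E]) detector_event x t k.
Proof. by apply/seteqP; split=> [w [k]|w [k]]; exists k. Qed.

Lemma measurable_noise_event u (B : set R) : measurable B ->
  measurable [set w | B (dotv u (xi w))].
Proof.
move=> mB; have [mu _] := xi_gauss u.
by rewrite -[X in measurable X]setTI; exact: mu.
Qed.

(** Measurability is given for linear functionals of [xi], so the event is rewritten as a half-line
    condition on one of them. *)
Lemma measurable_detector_event x t k : measurable (detector_event x t k).
Proof.
pose c := dotv (sp_h D eps epst p t k (rho t k)) (Abar D t *m x) - 2^-1 *
  (dotv (sp_h D eps epst p t k (rho t k)) (sp_th1 D eps epst p t k (rho t k))
   + dotv (sp_h D eps epst p t k (rho t k)) (sp_th2 D eps epst p t k (rho t k))).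
rewrite (_ : detector_event x t k = [set w |
    `]-oo, (alpha_at D eps epst t - c)[%classic (dotv (noise_direction p t k) (xi w))]).
  exact: measurable_noise_event.
by apply/seteqP; split=> w; rewrite /detector_event /= detectorE in_itv/= ltrBrDl.
Qed.

Lemma measurable_test_event x t : measurable (test_event x t).
Proof.
rewrite test_eventE; apply: fin_bigcup_measurable; first exact: finite_finset.
by move=> k _; exact: measurable_detector_event.
Qed.

Lemma signal_eventE x t : signal_event p xi x t =
  test_event x t `\` \bigcup_(s in [set s : 'I_d.+1 | (s < t)%N]) test_event x s.
Proof.
apply/seteqP; split=> w.
  by move=> [tw nw]; split=> // -[s st]; exact: nw.
by move=> [tw nw]; split=> // s st sw; apply: nw; exists s.
Qed.

Lemma measurable_signal_event x t : measurable (signal_event p xi x t).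
Proof.
rewrite signal_eventE; apply: measurableD; first exact: measurable_test_event.
apply: fin_bigcup_measurable; first exact: finite_finset.
by move=> s _; exact: measurable_test_event.
Qed.

(** The first time at which a test fires produces the signal conclusion. *)
Lemma test_event_sub_signal x t : test_event x t `<=`
  \bigcup_(s in [set s : 'I_d.+1 | (s <= t)%N]) signal_event p xi x s.
Proof.
move=> w tw.
have ex_fire : exists m : nat, `[< exists s : 'I_d.+1, s = m :> nat /\ test_event x s w >].
  by exists t; apply/asboolP; exists t.
case: (ex_minnP ex_fire) => m /asboolP[s [<- sw]] s_min; exists s => /=.
  by apply: s_min; apply/asboolP; exists t.
split=> // r rs rw; have : (s <= r)%N by apply: s_min; apply/asboolP; exists r.
by rewrite leqNgt rs.
Qed.

(** The shape [k] makes the cardinality positive, so the argument of [ErfInv] is at most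
    [epst t <= eps < 1/2], away from both conventional zero values. *)
Lemma ErfInv_div_bounds t k : k \in calL D t (dt t) ->
  0 < ErfInv_div (epst t) (Lcard D t (dt t)) /\
  Erf (ErfInv_div (epst t) (Lcard D t (dt t))) <= epst t / (Lcard D t (dt t))%:R.
Proof.
move=> kL; have L0 : (0 < Lcard D t (dt t))%N by apply/card_gt0P; exists k.
rewrite /ErfInv_div gtn_eqF//; apply: ErfInv_bounds.
rewrite divr_gt0 ?ltr0n//=; apply: le_lt_trans eps_lt_half.
rewrite (le_trans _ (epst_le t))// ler_pdivrMr ?ltr0n// ler_peMr ?ler1n//.
exact: ltW.
Qed.

Lemma false_alarm_shape x t k : Nset D x -> (rho_at p t k < +oo)%E ->
  (P (detector_event x t k) <= (epst t / (Lcard D t (dt t))%:R)%:E)%E.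
Proof.
move=> Nx fin_rho; have kL := shape_in_calL p t k fin_rho.
have [b0 Eb] := ErfInv_div_bounds t k kL.
have [dt0 dtb] := delta_at_bounds D eps epst t.
set b := ErfInv_div _ _ in b0 Eb dtb.
have [_ lawB] := xi_gauss (noise_direction p t k).
apply: (@le_trans _ _ (P [set w |
    `]-oo, (- (dt t * b))[%classic (dotv (noise_direction p t k) (xi w))])).
  apply: le_measure; rewrite ?inE.
  - exact: measurable_detector_event.
  - exact: measurable_noise_event.
  - move=> w; rewrite /detector_event /= in_itv/=.
    have := detector_nuisance p t k fin_rho x (xi w) Nx.
    rewrite -/(rho t k) -/(dt t) /alpha_at -/(dt t) -/b.
    (* alpha - delta^2 <= - delta b, because 2 delta >= ErfInv eps + b *)
    move: dt0 dtb; rewrite -/(dt t); nra.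
rewrite lawB//; apply: (@le_trans _ _ (Erf b)%:E); last by rewrite lee_fin.
apply: centered_normal_lower_tail => //; last exact: ltW.
exact: noise_variance_bounds.
Qed.

Lemma false_alarm_time x t : Nset D x -> (P (test_event x t) <= (epst t)%:E)%E.
Proof.
move=> Nx; set L := Lcard D t (dt t).
apply: (@le_trans _ _ (\sum_(k in calL D t (dt t)) epst t / L%:R)%:E); last first.
  rewrite lee_fin sumr_const -/(Lcard D t (dt t)) -/L.
  (* Without shapes the sum is empty; otherwise [L] equal shares add up to [epst t]. *)
  have [->|L0] := eqVneq L 0%N; first by rewrite mulr0n ltW.
  by rewrite -[_ *+ L]mulr_natr divfK// pnatr_eq0.
have rho_fin k : k \in calL D t (dt t) -> (rho_at p t k < +oo)%E.
  by move=> /(rho_at_in _ _ _ p)[r [-> _ _]]; exact: ltry.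
apply: (content_finite_union_bound P (calL D t (dt t)) _ (detector_event x t)).
- exact: measurable_test_event.
- by move=> k _; exact: measurable_detector_event.
- by rewrite test_eventE => w [k kfin kw]; exists k => //; exact: shape_in_calL kfin.
- by move=> k /rho_fin; exact: false_alarm_shape.
Qed.

Lemma missed_detection_shape x t k (rho' : R) :
  (rho_at p t k < +oo)%E -> (rho_at p t k <= rho'%:E)%E -> Xsig D k rho' x ->
  (P (~` detector_event x t k) <= eps%:E)%E.
Proof.
move=> fin_rho le_rho Xx; have kL := shape_in_calL p t k fin_rho.
have [b0 _] := ErfInv_div_bounds t k kL.
have [a0 Ea] : 0 < ErfInv eps /\ Erf (ErfInv eps) <= eps.
  by apply: ErfInv_bounds; rewrite eps_gt0.
have [_ dtb] := delta_at_bounds D eps epst t.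
set b := ErfInv_div _ _ in b0 dtb.
(* [delta] is at least the average of two positive quantiles. *)
have dt0 : 0 < dt t by rewrite /dt; lra.
have [_ lawB] := xi_gauss (noise_direction p t k).
apply: (@le_trans _ _ (P [set w |
    `[(dt t * ErfInv eps), +oo[%classic (dotv (noise_direction p t k) (xi w))])).
  apply: le_measure; rewrite ?inE.
  - by apply: measurableC; exact: measurable_detector_event.
  - exact: measurable_noise_event.
  - move=> w /negP; rewrite -leNgt /= in_itv/= andbT.
    have := detector_signal p t k fin_rho x (xi w) rho' le_rho Xx.
    rewrite -/(rho t k) -/(dt t) /alpha_at -/(dt t) -/b.
    (* [alpha + delta^2 >= delta * ErfInv eps], again because [2 delta >= ErfInv eps + b]. *)
    move: dt0 dtb; rewrite -/(dt t); nra.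
rewrite lawB//; apply: (@le_trans _ _ (Erf (ErfInv eps))%:E); last by rewrite lee_fin.
by apply: centered_normal_upper_tail => //; exact: noise_variance_bounds.
Qed.

End Probabilities.

Theorem proposition3p3 (R : realType) (n d K : nat)
  (D : detection_problem R n d K)
  (eps : R) (epst : 'I_d.+1 -> R)
  (eps_gt0 : 0 < eps) (eps_lt_half : eps < 2^-1)
  (epst_gt0 : forall t, 0 < epst t)
  (epst_sum : \sum_t epst t = eps)
  (p : procedure D eps epst)
  (dsp : measure_display) (T : measurableType dsp) (P : probability T R)
  (Theta : 'M[R]_(nu D ord_max)) (Theta_in : covs D Theta)
  (xi : T -> 'cV[R]_(nu D ord_max)) (xi_gauss : gaussian_vector P xi Theta) :
  (forall x : 'cV[R]_n, Nset D x ->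
     (forall t, (P (signal_event p xi x t) <= (epst t)%:E)%E) /\
     (P (\bigcup_t signal_event p xi x t) <= eps%:E)%E)
  /\
  (forall (t : 'I_d.+1) (k : 'I_K), (rho_at p t k < +oo)%E ->
     forall (rho : R) (x : 'cV[R]_n),
       (rho_at p t k <= rho%:E)%E -> Xsig D k rho x ->
       ((1 - eps)%:E <=
          P (\bigcup_(s in [set s : 'I_d.+1 | (s <= t)%N]) signal_event p xi x s))%E).
Proof.
have epst_le t : epst t <= eps.
  rewrite -epst_sum (bigD1 t)//= lerDl; apply: sumr_ge0 => s _; exact: ltW.
have mS := measurable_signal_event p P xi xi_gauss.
have mT := measurable_test_event p P xi xi_gauss.
have mdet := measurable_detector_event p P xi xi_gauss.
split=> [x Nx|t k fin_rho rho x le_rho Xx].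
  have bound_t t : (P (signal_event p xi x t) <= (epst t)%:E)%E.
    apply: le_trans (false_alarm_time p P Theta_in xi xi_gauss eps_lt_half
      epst_gt0 epst_le x t Nx).
    apply: le_measure; rewrite ?inE.
    - exact: mS.
    - exact: mT.
    - by rewrite signal_eventE; exact: subDsetl.
  have sumT : \sum_(t in [set: 'I_d.+1]%SET) epst t = eps.
    by rewrite -epst_sum; apply: eq_bigl => t; rewrite finset.in_setT.
  split=> //; apply: (@le_trans _ _ (\sum_(t in [set: 'I_d.+1]%SET) epst t)%:E);
    last by rewrite sumT.
  apply: (content_finite_union_bound P [set: 'I_d.+1]%SET _ (signal_event p xi x)) => //.
  - by apply: fin_bigcup_measurable => //; exact: finite_finset.
  - by move=> w [t _ tw]; exists t => //=; rewrite finset.in_setT.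
  - by move=> t _; exact: bound_t.
(* The detector of shape [k] alone suffices: when it fires, the test at [t] fires, so a conclusion
   comes at [t] or earlier. *)
have le_det : ((1 - eps)%:E <= P (detector_event p xi x t k))%E.
  rewrite -[X in P X]setCK probability_setC; last exact: measurableC.
  rewrite EFinB leeB//.
  exact: (missed_detection_shape p P Theta_in xi xi_gauss eps_gt0 eps_lt_half
            epst_gt0 epst_le x t k rho fin_rho le_rho Xx).
apply: (le_trans le_det); apply: le_measure; rewrite ?inE.
- exact: mdet.
- by apply: fin_bigcup_measurable => //; exact: finite_finset.
- apply: subset_trans (test_event_sub_signal p xi x t).
  by rewrite test_eventE => w kw; exists k.
Qed.
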